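(* There exist a finitely generated nonabelian free group $L$ and a faithful action $\phi\colon L\to\mathrm{Homeo}_+(S^1)$ such that $\mathrm{rot}(\phi(g))=0$ for every $g\in L$ and such that, for every $k\ge 1$, $\phi$ is not semi-conjugate to any action of $L$ with image contained in $\mathrm{PSL}_2^{(k)}(\mathbb{R})$.
   Context: $S^1=\mathbb{R}/\mathbb{Z}$. $\mathrm{PSL}_2^{(k)}(\mathbb{R})$ is the connected $k$-fold cover of $\mathrm{PSL}_2(\mathbb{R})$; it acts on the circle $\mathbb{R}/k\mathbb{Z}\cong S^1$ by lifting the action of $\mathrm{PSL}_2(\mathbb{R})\cong\mathrm{Isom}^+(\mathbb{H}^2)$ on $\partial\mathbb{H}^2=\mathbb{R}/\mathbb{Z}$ along the $k$-fold cover $\mathbb{R}/k\mathbb{Z}\to\mathbb{R}/\mathbb{Z}$, and is thereby regarded as a subgroup of $\mathrm{Homeo}_+(S^1)$. The rotation number is $\mathrm{rot}(f)=\lim_{n\to\infty}\tilde f^n(0)/n \bmod \mathbb{Z}$ for any lift $\tilde f$ of $f$ to $\mathbb{R}$. Let $T(x)=x+1$ on $\mathbb{R}$, let $\mathrm{Homeo}_{\mathbb{Z}}(\mathbb{R})$ be the group of orientation-preserving homeomorphisms of $\mathbb{R}$ commuting with $T$, and $p\colon\mathrm{Homeo}_{\mathbb{Z}}(\mathbb{R})\to\mathrm{Homeo}_+(S^1)$ the projection. Two actions $\rho_0,\rho_1\colon L\to\mathrm{Homeo}_+(S^1)$ are semi-conjugate if there are a group $\tilde L$, homomorphisms $q\colon\tilde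 L\to L$, $j\colon\mathbb{Z}\to\tilde L$ with $q\circ j$ trivial, and $\tilde\rho_0,\tilde\rho_1\colon\tilde L\to\mathrm{Homeo}_{\mathbb{Z}}(\mathbb{R})$ such that, for $i=0,1$, $\tilde\rho_i(j(1))=T$, $p\circ\tilde\rho_i=\rho_i\circ q$, and $(\tilde\rho_i,q)$ identifies $\tilde L$ with the fiber product $\{(f,g): p(f)=\rho_i(g)\}$, and such that there is a (possibly discontinuous) proper nondecreasing map $h\colon\mathbb{R}\to\mathbb{R}$ with $h\circ\tilde\rho_0(x)=\tilde\rho_1(x)\circ h$ for all $x\in\tilde L$. *)

(* Defs.v *)
From HB Require Import structures.
From mathcomp Require Import all_boot all_order all_algebra.
From mathcomp Require Import all_classical all_reals all_analysis.

Set Implicit Arguments.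
Unset Strict Implicit.
Unset Printing Implicit Defensive.

Import Order.TTheory GRing.Theory Num.Theory.
Import numFieldNormedType.Exports.

Local Open Scope classical_set_scope.
Local Open Scope ring_scope.
Local Open Scope quotient_scope.

Definition free_basis (L : groupType) (B : set L) : Prop :=
  forall (H : groupType) (f : L -> H),
    exists phi : {multiplicative L -> H},
      (forall b, B b -> phi b = f b) /\
      (forall psi : {multiplicative L -> H},
         (forall b, B b -> psi b = f b) -> psi =1 phi).

Definition free_group (L : groupType) : Prop := exists B : set L, free_basis B.

Definition finitely_generated (L : groupType) : Prop :=
  exists s : seq L, forall S : {pred L},
    group_closed S -> {subset s <= S} -> forall g, g \in S.

Definition nonabelian (L : groupType) : Prop := exists x y : L, ~ commute x y.

Definition homeomorphism (T U : topologicalType) (f : T -> U) : Prop :=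
  continuous f /\ exists g : U -> T, [/\ continuous g, cancel f g & cancel g f].

Record Homeo (T : topologicalType) := MkHomeo {
  homeo_fun :> T -> T ;
  homeoP : homeomorphism homeo_fun }.

HB.instance Definition _ (T : topologicalType) := gen_eqMixin (Homeo T).
HB.instance Definition _ (T : topologicalType) := gen_choiceMixin (Homeo T).

Section HomeoGroup.
Variable T : topologicalType.
Implicit Types f g : Homeo T.

Lemma homeo_ext f g : f =1 g -> f = g.
Proof.
case: f g => [f fP] [g gP] /= /funext fg; subst g.
by congr MkHomeo; exact: Prop_irrelevance.
Qed.

Lemma homeomorphism_id : homeomorphism (@idfun T).
Proof. by split; [|exists idfun; split]; move=> // x; exact: cvg_id. Qed.

Definition homeo_id : Homeo T := MkHomeo homeomorphism_id.

Lemma homeomorphism_comp f g : homeomorphism (f \o g).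
Proof.
case: f g => [f [fc [f' [f'c fK f'K]]]] [g [gc [g' [g'c gK g'K]]]] /=.
split; first by move=> x; apply: continuous_comp; [exact: gc|exact: fc].
exists (g' \o f'); split; [|exact: can_comp|exact: can_comp].
by move=> x; apply: continuous_comp; [exact: f'c|exact: g'c].
Qed.

Definition homeo_comp f g : Homeo T := MkHomeo (homeomorphism_comp f g).

Definition homeo_inv_fun f : T -> T := sval (cid (homeoP f).2).

Lemma homeo_invP f :
  [/\ continuous (homeo_inv_fun f), cancel f (homeo_inv_fun f)
    & cancel (homeo_inv_fun f) f].
Proof. by rewrite /homeo_inv_fun; case: cid. Qed.

Lemma homeomorphism_inv f : homeomorphism (homeo_inv_fun f).
Proof.
by have [fc fK f'K] := homeo_invP f; split=> //; exists f; split=> //;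
  exact: (homeoP f).1.
Qed.

Definition homeo_inv f : Homeo T := MkHomeo (homeomorphism_inv f).

Lemma homeo_compA : associative homeo_comp.
Proof. by move=> f g h; exact: homeo_ext. Qed.
Lemma homeo_comp1f : left_id homeo_id homeo_comp.
Proof. by move=> f; exact: homeo_ext. Qed.
Lemma homeo_compf1 : right_id homeo_id homeo_comp.
Proof. by move=> f; exact: homeo_ext. Qed.
Lemma homeo_compVf : left_inverse homeo_id homeo_inv homeo_comp.
Proof. by move=> f; apply: homeo_ext; case: (homeo_invP f). Qed.
Lemma homeo_compfV : right_inverse homeo_id homeo_inv homeo_comp.
Proof. by move=> f; apply: homeo_ext; case: (homeo_invP f). Qed.

HB.instance Definition _ := isGroup.Build (Homeo T)
  homeo_compA homeo_comp1f homeo_compf1 homeo_compVf homeo_compfV.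

Lemma homeo1E x : (1%g : Homeo T) x = x. Proof. by []. Qed.
Lemma homeoME f g x : (f * g)%g x = f (g x). Proof. by []. Qed.

End HomeoGroup.

Section CircleDef.
Variable R : realType.

Definition circle_rel : rel R := fun x y => x - y \is a Num.int.

Lemma circle_rel_equiv : equiv_class_of circle_rel.
Proof.
split=> [x|x y|y x z] /=; rewrite /circle_rel.
- by rewrite subrr rpred0.
- by rewrite -opprB rpredN.
- by move=> xy yz; rewrite -(subrK y x) -addrA rpredD.
Qed.

Canonical circle_equiv := EquivRelPack circle_rel_equiv.

Definition circle : topologicalType :=
  quotient_topology {eq_quot circle_equiv}.

Definition cproj (x : R) : circle :=
  \pi_(quotient_topology {eq_quot circle_equiv})%qT x.

Definition crepr (z : circle) : R :=
  repr (z : quotient_topology {eq_quot circle_equiv}).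

Lemma creprK : cancel crepr cproj.
Proof. exact: reprK. Qed.

Lemma cproj_eq (x y : R) : cproj x = cproj y <-> x - y \is a Num.int.
Proof. by split=> [/eqmodP|xy]; [|exact/eqmodP]. Qed.

Lemma cproj_continuous : continuous cproj.
Proof. exact: pi_continuous. Qed.

Lemma circle_continuous (Z : topologicalType) (f : circle -> Z) :
  continuous f <-> continuous (f \o cproj).
Proof. exact: quotient_continuous. Qed.

(* p F = f, where p : Homeo_Z(R) -> Homeo_+(S^1) is the projection *)
Definition projects (F : R -> R) (f : circle -> circle) : Prop :=
  forall x, cproj (F x) = f (cproj x).

Definition Homeo_Z : set (Homeo R) :=
  [set F | {homo F : x y / x < y} /\ forall x, F (x + 1) = F x + 1].

(* A homeomorphism of the circle preserves the orientation iff it lifts to an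
   increasing homeomorphism of the line. *)
Definition Homeo_plus : set (Homeo circle) :=
  [set f | exists2 F : Homeo R, Homeo_Z F & projects F f].

Definition is_rotation_number (f : Homeo circle) (a : circle) : Prop :=
  forall F : Homeo R, Homeo_Z F -> projects F f ->
    exists2 r : R, (fun n : nat => iter n F 0 / n%:R) @ \oo --> r
                 & cproj r = a.

(* The boundary of the hyperbolic plane is the real projective line; [x] in
   R/Z is the line spanned by (cos (pi x), sin (pi x)). *)
Definition direction (x : R) : 'cV[R]_2 :=
  \col_i (if i == 0 then cos (pi * x) else sin (pi * x)).

Definition PSL2 : set (Homeo circle) :=
  [set g | exists2 A : 'M[R]_2, \det A = 1 &
     forall x y, g (cproj x) = cproj y ->
       exists c : R, A *m direction x = c *: direction y].

(* The k-fold cover R/kZ -> R/Z, where R/kZ is identified with R/Z by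
   x |-> x / k. *)
Definition kcover (k : nat) (z : circle) : circle := cproj (k%:R * crepr z).

Lemma kcoverE k x : kcover k (cproj x) = cproj (k%:R * x).
Proof.
apply/cproj_eq; rewrite -mulrBr rpredM//; first exact: rpred_nat.
by apply/cproj_eq; rewrite creprK.
Qed.

(* The k-fold connected cover of PSL_2(R), as a group of homeomorphisms of
   R/kZ: all the lifts of elements of PSL_2(R) along R/kZ -> R/Z. The fibre
   over 1 is the group of the k deck transformations. As PSL_2(R) is connected,
   the group of lifts is connected because the rotations, which form a
   connected subgroup containing all deck transformations, belong to it
   (PSL2k_rotation). *)
Definition PSL2k (k : nat) : set (Homeo circle) :=
  [set f | Homeo_plus f /\
     exists2 g, PSL2 g & forall z, kcover k (f z) = g (kcover k z)].

Lemma translation_homeomorphism (t : R) : homeomorphism (fun x : R => x + t).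
Proof.
have c (s : R) : continuous (fun x : R => x + s).
  by move=> x; apply: cvgD; [exact: cvg_id|exact: cvg_cst].
by split=> //; exists (fun x => x - t); split=> // x; rewrite ?addrK ?subrK.
Qed.

Definition translation (t : R) : Homeo R :=
  MkHomeo (translation_homeomorphism t).

Definition rotation_fun (t : R) (z : circle) : circle := cproj (crepr z + t).

Lemma rotation_funE t x : rotation_fun t (cproj x) = cproj (x + t).
Proof.
apply/cproj_eq; rewrite opprD addrACA subrr addr0.
by apply/cproj_eq; rewrite creprK.
Qed.

Lemma rotation_homeomorphism t : homeomorphism (rotation_fun t).
Proof.
have c s : continuous (rotation_fun s).
  apply/circle_continuous.
  rewrite (_ : _ \o _ = cproj \o translation s); last first.
    by apply/funext => x /=; rewrite rotation_funE.
  move=> x; apply: continuous_comp; last exact: cproj_continuous.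
  exact: (translation_homeomorphism s).1.
split=> //; exists (rotation_fun (- t)); split=> // z;
by rewrite -[z]creprK !rotation_funE ?addrK ?subrK.
Qed.

Definition rotation (t : R) : Homeo circle :=
  MkHomeo (rotation_homeomorphism t).

Lemma rotation_plus t : Homeo_plus (rotation t).
Proof.
exists (translation t) => [|x /=]; last by rewrite rotation_funE.
by split=> [x y /=|x /=]; [rewrite ltrD2r|rewrite addrAC].
Qed.

Lemma direction_int (x y : R) : cproj x = cproj y ->
  exists c : R, direction x = c *: direction y.
Proof.
move=> /cproj_eq /intrP [m xy].
have {xy} -> : x = y + m%:~R by rewrite -xy addrC subrK.
have P n : exists c : R, direction (y + n%:R) = c *: direction y.
  elim: n => [|n [c IH]]; first by exists 1; rewrite addr0 scale1r.
  exists (- c); rewrite scaleNr -IH; apply/matrixP => i j; rewrite !mxE.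
  by rewrite -natr1 addrA [pi * (_ + 1)]mulrDr mulr1 cosDpi sinDpi; case: ifP.
have N n : exists c : R, direction (y - n%:R) = c *: direction y.
  elim: n => [|n [c IH]]; first by exists 1; rewrite subr0 scale1r.
  exists (- c); rewrite scaleNr -IH; apply/matrixP => i j; rewrite !mxE.
  have -> : pi * (y - n%:R) = pi * (y - n.+1%:R) + pi.
    by rewrite -{3}[pi]mulr1 -mulrDr -natr1 opprD addrA subrK.
  by rewrite cosDpi sinDpi; case: ifP; rewrite opprK.
by case: m => n; [exact: P|rewrite NegzE mulrNz; exact: N].
Qed.

Lemma PSL2_rotation t : PSL2 (rotation t).
Proof.
pose c := cos (pi * t); pose s := sin (pi * t).
pose A : 'M[R]_2 := \matrix_(i, j)
  (if i == j then c else if i == 0 then - s else s).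
exists A.
  rewrite (expand_det_row _ ord0) !big_ord_recl big_ord0 /cofactor !det_mx11.
  by rewrite !mxE /= expr0 expr1 mul1r addr0 mulN1r mulrNN -!expr2 cos2Dsin2.
move=> x y; rewrite /= rotation_funE => /direction_int [d dE].
exists d; rewrite -dE; apply/matrixP => i j; rewrite !mxE !big_ord_recl big_ord0.
rewrite !mxE /= addr0 mulrDr cosD sinD -/c -/s.
by case: i => -[|[|//]] ?; rewrite /= ?mulNr; [congr (_ - _)|rewrite addrC];
  rewrite ?[_ * c]mulrC ?[_ * s]mulrC.
Qed.

Lemma PSL2k_rotation k t : PSL2k k (rotation t).
Proof.
split; first exact: rotation_plus.
exists (rotation (k%:R * t)); first exact: PSL2_rotation.
by move=> z; rewrite -[z]creprK /= rotation_funE !kcoverE rotation_funE mulrDr.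
Qed.

(* Since h need not be continuous, properness asks that preimages of compact
   sets be bounded (they need not be closed). *)
Definition proper_map (h : R -> R) : Prop :=
  forall K : set R, compact K -> bounded_set (h @^-1` K).

End CircleDef.

Section SemiConjugacy.
Variables (R : realType) (L : groupType).

Record circle_action := CircleAction {
  action_mor :> {multiplicative L -> Homeo (circle R)} ;
  action_plus : forall g, Homeo_plus (action_mor g) }.

Definition lifted_action (Lt : groupType) (q : {multiplicative Lt -> L})
    (j : int -> Lt) (rho : circle_action)
    (rhot : {multiplicative Lt -> Homeo R}) : Prop :=
  [/\ forall x, Homeo_Z (rhot x),
      forall t, rhot (j 1) t = t + 1,
      forall x, projects (rhot x) (rho (q x))
    & set_bij [set: Lt]
        [set Fg : Homeo R * L | Homeo_Z Fg.1 /\ projects Fg.1 (rho Fg.2)]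
        (fun x => (rhot x, q x))].

Definition semiconjugate (rho0 rho1 : circle_action) : Prop :=
  exists (Lt : groupType) (q : {multiplicative Lt -> L}) (j : int -> Lt)
         (rhot0 rhot1 : {multiplicative Lt -> Homeo R}),
    [/\ forall m n, j (m + n) = (j m * j n)%g,
        forall m, q (j m) = 1%g,
        lifted_action q j rho0 rhot0,
        lifted_action q j rho1 rhot1
      & exists h : R -> R,
          [/\ proper_map h, {homo h : s t / s <= t}
            & forall x t, h (rhot0 x t) = rhot1 x (h t)]].

End SemiConjugacy.

(* Main.v *)
Require Import Defs.
From HB Require Import structures.
From mathcomp Require Import all_boot all_order all_algebra.
From mathcomp Require Import all_classical all_reals all_analysis.
From mathcomp Require Import lra zify.

(** The example is a ping-pong action of a free group on three generators [a],
    [b], [c]. Cut the circle at the eight points n/8. The generator [a] has four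
    fixed points, repelling at 0, 1/2 and attracting at 1/4, 3/4; it is the
    lift, through the double cover of the circle, of a map with one source and
    one sink. The generators [b] and [c] have one sink and one source each, at 1/8,
    5/8 and at 3/8, 7/8. All three contract so strongly that they play ping-pong
    with the windows of radius 1/32 around the eight points: a letter sends
    whatever is outside the windows around its repelling points into one of the
    windows around its attracting points.

    Ping-pong gives freeness and faithfulness ([reduced_word_moves]): a nonempty
    reduced word moves the point 1/16, which lies outside all the windows. It
    also gives fixed points ([word_fixes_mod_int]). A power of [a] fixes the
    fixed points of [a]. Any other element is conjugate to a cyclically reduced
    word starting with [b], [c] or an inverse of one of them; such a letter has
    a single attracting window on the circle, so the word maps this window into
    itself.

    Suppose now that the action is semi-conjugate, through a monotone map [h],
    to an action in the [k]-fold cover of PSL_2. The lifts to the line of the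
    latter commute with the translation by 1/k. The elements [a] and
    b^-1 a b have fixed points, hence so do their images, which therefore move
    every point up by less than 1/k; but their product a b^-1 a b goes around a
    full turn at some point ([full_turn]). Since this survives in the image,
    1 < 2/k and k = 1 ([degree_one]). The same full turn shows that the images
    of [a] and [b] have no common fixed point, and neither do those of [a] and
    [c]. As fixed points of [b] and [c] separate the fixed points 0, 1/4, 1/2 of
    [a] from each other, [h] keeps these three apart ([separated]). So the image
    of [a] is an element of PSL_2 with three fixed points on the circle: it is
    the identity ([PSL2_three_fixpoints]), and it shares the fixed points of the
    image of [b], a contradiction. *)

Set Implicit Arguments.
Unset Strict Implicit.
Unset Printing Implicit Defensive.

Import Order.TTheory GRing.Theory Num.Theory.
Import numFieldNormedType.Exports.

Local Open Scope classical_set_scope.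
Local Open Scope ring_scope.

(** * Homeomorphisms of the line and of the circle *)

Section Line.
Variable R : realType.
Implicit Types (F G : Homeo R) (f g : R -> R) (p t u x y : R).

Lemma monotone_inverse_homeomorphism f g :
  {homo f : x y / x < y} -> {homo g : x y / x < y} ->
  cancel f g -> cancel g f -> homeomorphism f.
Proof.
have c f' g' : {homo f' : x y / x < y} -> {homo g' : x y / x < y} ->
    cancel f' g' -> cancel g' f' -> continuous f'.
  move=> fI gI fK gK x; apply/cvgrPdist_lt => e e0.
  have lo : g' (f' x - e) < x by rewrite -{2}(fK x) gI// ltrBlDr ltrDl.
  have hi : x < g' (f' x + e) by rewrite -{1}(fK x) gI// ltrDl.
  near=> y.
  have ly : g' (f' x - e) < y by near: y; exact: lt_nbhsr.
  have yh : y < g' (f' x + e) by near: y; exact: lt_nbhsl.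
  have := fI _ _ ly; have := fI _ _ yh; rewrite !gK => ? ?.
  by rewrite distrC ltr_distl; apply/andP.
by move=> fI gI fK gK; split; [exact: (c f g)|exists g; split=> //; exact: (c g f)].
Unshelve. all: by end_near. Qed.

Lemma commute_translation F p : (forall t, F (t + p) = F t + p) ->
  forall (n : int) t, F (t + n%:~R * p) = F t + n%:~R * p.
Proof.
move=> Fp; have P (k : nat) t : F (t + k%:R * p) = F t + k%:R * p.
  elim: k => [|k IH]; first by rewrite mul0r !addr0.
  by rewrite -natr1 mulrDl mul1r !addrA Fp IH.
case=> k t; first exact: P.
by rewrite NegzE mulrNz mulNr; apply/eqP; rewrite -subr_eq opprK -P subrK.
Qed.

Lemma HomeoZ_add_int F x (n : int) : Homeo_Z F -> F (x + n%:~R) = F x + n%:~R.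
Proof. by move=> [_ FT]; have := commute_translation FT n x; rewrite mulr1. Qed.

Lemma HomeoZ_lt F : Homeo_Z F -> {mono F : x y / x < y}.
Proof. by move=> [FI _]; apply: leW_mono; exact: le_mono. Qed.

Lemma HomeoZ_le F : Homeo_Z F -> {mono F : x y / x <= y}.
Proof. by move=> [FI _]; exact: le_mono. Qed.

Lemma HomeoZ1 : Homeo_Z (1%g : Homeo R).
Proof. by split. Qed.

Lemma HomeoZM F G : Homeo_Z F -> Homeo_Z G -> Homeo_Z (F * G)%g.
Proof.
move=> [FI FT] [GI GT]; split=> [x y xy|x]; rewrite !homeoME; first exact/FI/GI.
by rewrite GT FT.
Qed.

Lemma homeoVK (T : topologicalType) (F : Homeo T) : cancel F (F^-1)%g.
Proof. by move=> x; rewrite -homeoME mulVg. Qed.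

Lemma homeoKV (T : topologicalType) (F : Homeo T) : cancel (F^-1)%g F.
Proof. by move=> x; rewrite -homeoME mulgV. Qed.

Lemma HomeoZV F : Homeo_Z F -> Homeo_Z (F^-1)%g.
Proof.
move=> FZ; split=> [x y xy|x]; first by rewrite -(HomeoZ_lt FZ) !homeoKV.
by apply: (can_inj (homeoVK F)); rewrite FZ.2 !homeoKV.
Qed.

(** A fixed point of [F] has translates by all the multiples of [p] for
    company, and [F] cannot jump over any of them. *)
Lemma fixpoint_displacement F p u t : Homeo_Z F -> 0 < p ->
  (forall t, F (t + p) = F t + p) -> F u = u -> t - p < F t /\ F t < t + p.
Proof.
move=> FZ p0 Fp Fu; pose n := Num.floor ((t - u) / p).
have Fn (m : int) : F (u + m%:~R * p) = u + m%:~R * p.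
  by rewrite commute_translation// Fu.
have := floor_le_tmp ((t - u) / p); have := floorD1_gt ((t - u) / p).
rewrite -/n ltr_pdivrMr// ler_pdivlMr// => hi lo.
have lo' : u + n%:~R * p <= t by lra.
have hi' : t < u + (n + 1)%:~R * p by lra.
rewrite -(HomeoZ_le FZ) Fn in lo'; rewrite -(HomeoZ_lt FZ) Fn in hi'.
rewrite intrD1 mulrDl mul1r in hi hi'; split; lra.
Qed.

Definition circle_fun F (z : circle R) : circle R := cproj (F (crepr z)).

Lemma circle_funE F : Homeo_Z F -> forall x, circle_fun F (cproj x) = cproj (F x).
Proof.
move=> FZ x; apply/cproj_eq.
have /cproj_eq/intrP[n nE] : cproj (crepr (cproj x)) = cproj x by rewrite creprK.
have -> : crepr (cproj x) = x + n%:~R by rewrite -nE addrC subrK.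
by rewrite HomeoZ_add_int// addrAC subrr add0r intr_int.
Qed.

Lemma circle_fun_homeomorphism F : Homeo_Z F -> homeomorphism (circle_fun F).
Proof.
have c G : Homeo_Z G -> continuous (circle_fun G).
  move=> GZ; apply/circle_continuous.
  have -> : circle_fun G \o (@cproj R) = (@cproj R) \o G.
    by apply/funext => x /=; rewrite circle_funE.
  by move=> x; apply: continuous_comp; [exact: (homeoP G).1|exact: cproj_continuous].
move=> FZ; split; first exact: c.
exists (circle_fun (F^-1)%g); split; first exact/c/HomeoZV.
- by move=> z; rewrite -[z]creprK !circle_funE ?homeoVK//; exact: HomeoZV.
- by move=> z; rewrite -[z]creprK !circle_funE ?homeoKV//; exact: HomeoZV.
Qed.

(** The orbit of [x] advances by exactly [m] at each step, and an integer close
    to [x] follows it to within 1, since [F] is monotone and 1-periodic. *)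
Lemma translation_number_int F x (m : int) : Homeo_Z F -> F x = x + m%:~R ->
  (fun n : nat => iter n F 0 / n%:R) @ \oo --> (m%:~R : R).
Proof.
move=> FZ Fx.
have it n : iter n F x = x + (m * n)%:~R.
  elim: n => [|n IH]; first by rewrite mulr0 addr0.
  rewrite iterS IH HomeoZ_add_int// Fx -addrA -intrD; congr (_ + _%:~R); lia.
have itI n : {homo iter n F : s t / s <= t}.
  by elim: n => // n IH s t st; rewrite !iterS HomeoZ_le// IH.
have itT n y (k : int) : iter n F (y + k%:~R) = iter n F y + k%:~R.
  by elim: n => // n IH; rewrite !iterS IH HomeoZ_add_int.
pose q := Num.floor x.
have q0 : q%:~R <= x < q%:~R + 1 by rewrite floor_le_tmp -intrD1 floorD1_gt.
have bd n : `|iter n F 0 - m%:~R * n%:R| <= 1.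
  have h1 : iter n F q%:~R <= x + m%:~R * n%:R.
    by rewrite -[n%:R]/(n%:~R) -intrM -it itI//; case/andP: q0.
  have h2 : x + m%:~R * n%:R <= iter n F (q%:~R + 1).
    by rewrite -[n%:R]/(n%:~R) -intrM -it itI//; case/andP: q0 => _ /ltW.
  have := itT n 0 q; rewrite add0r => e1.
  have := itT n 0 (q + 1); rewrite add0r intrD => e2.
  rewrite e1 in h1; rewrite e2 in h2.
  rewrite ler_norml; lra.
apply/cvgrPdist_lt => e e0; near=> n.
have n0 : 0 < n%:R :> R by rewrite ltr0n; near: n; exact: nbhs_infty_gt.
have -> : m%:~R - iter n F 0 / n%:R = - (iter n F 0 - m%:~R * n%:R) / n%:R.
  by rewrite opprB mulrBl mulfK ?gt_eqF.
rewrite normrM normrN normfV (gtr0_norm n0) ltr_pdivrMr//.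
apply: le_lt_trans (bd n) _; rewrite -ltr_pdivrMl// mulr1.
by near: n; exact: nbhs_infty_gtr.
Unshelve. all: by end_near. Qed.

End Line.

(** * Words *)

Variant generator := ga | gb | gc.

Definition generator_code g : option bool :=
  match g with ga => None | gb => Some false | gc => Some true end.
Definition generator_decode o :=
  match o with None => ga | Some false => gb | Some true => gc end.
Lemma generator_codeK : cancel generator_code generator_decode.
Proof. by case. Qed.
HB.instance Definition _ := Equality.copy generator (can_type generator_codeK).

Definition letter := (generator * bool)%type.

Definition inv_letter (x : letter) : letter := (x.1, ~~ x.2).

Lemma inv_letterK : involutive inv_letter.
Proof. by case=> g []. Qed.

Section Words.
Variable H : groupType.
Implicit Types (f : generator -> H) (x y : letter) (v w : seq letter).

Definition letter_eval f x : H := if x.2 then f x.1 else ((f x.1)^-1)%g.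

Definition word_eval f w : H := foldr (fun x h => (letter_eval f x * h)%g) 1%g w.

Lemma word_eval_cons f x w : word_eval f (x :: w) = (letter_eval f x * word_eval f w)%g.
Proof. by []. Qed.

Lemma letter_evalV f x : letter_eval f (inv_letter x) = ((letter_eval f x)^-1)%g.
Proof. by case: x => g []; rewrite /letter_eval //= invgK. Qed.

Lemma word_eval_cat f v w : word_eval f (v ++ w) = (word_eval f v * word_eval f w)%g.
Proof. by elim: v => [|x v IH] /=; rewrite ?mul1g// IH mulgA. Qed.

Definition inv_word w := rev (map inv_letter w).

Lemma word_evalV f w : word_eval f (inv_word w) = ((word_eval f w)^-1)%g.
Proof.
rewrite /inv_word; elim: w => [|x w IH] /=; first by rewrite invg1.
by rewrite rev_cons -cats1 word_eval_cat IH /= mulg1 letter_evalV invgM.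
Qed.

Lemma word_eval_cancel f v x w :
  word_eval f (v ++ x :: inv_letter x :: w) = word_eval f (v ++ w).
Proof. by rewrite !word_eval_cat /= letter_evalV mulgA mulgA mulgK. Qed.

End Words.

Definition no_cancel : rel letter := fun x y => y != inv_letter x.

Lemma path_cancel x (w : seq letter) : ~~ path no_cancel x w ->
  exists s1 y s2, x :: w = s1 ++ y :: inv_letter y :: s2.
Proof.
elim: w x => // y w IH x /=; rewrite negb_and negbK => /orP[/eqP->|/IH].
  by exists [::], x, w.
by move=> [s1 [z [s2 ->]]]; exists (x :: s1), z, s2.
Qed.

(** * The eight points of the circle *)

Section Positions.
Implicit Types (x y : letter) (n j : int).

(** With positions counted in eighths, the distance between an attracting point
    and the next repelling point of the letter. *)
Definition half_step x : int := if x.1 is ga then 2 else 4.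

(** One attracting point in each orbit of the translations commuting with the
    letter; the repelling points are the attracting points of the inverse. *)
Definition attractor x : int :=
  match x with
  | (ga, true) => 2 | (ga, false) => 0
  | (gb, true) => 1 | (gb, false) => 5
  | (gc, true) => 3 | (gc, false) => 7
  end.

Definition attracts x (n : int) : bool := (2 * half_step x %| n - attractor x)%Z.

(** The six letters share out the integers mod 8: [a] takes 2 and 6, its inverse
    0 and 4, and each of the other letters one odd class. *)
Lemma attracts_inj x y n : attracts x n -> attracts y n -> x = y.
Proof.
by case: x y => [[] []] [[] []] //; rewrite /attracts /half_step /= => xn yn; exfalso; lia.
Qed.

Lemma attracts_inv x n : attracts (inv_letter x) (n + half_step x) = attracts x n.
Proof. by case: x => [[] []]; rewrite /attracts /half_step /=; lia. Qed.

Lemma nearest_attractor x (j : int) : exists2 n : int, attracts x n &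
  n - half_step x <= j < n + half_step x.
Proof.
exists (attractor x + 2 * half_step x *
  ((j - attractor x + half_step x) %/ (2 * half_step x))%Z)%R.
  by rewrite /attracts addrAC subrr add0r dvdz_mulr.
by case: x => [[] []]; rewrite /half_step /=; lia.
Qed.

(** The position [j] lies strictly between two repelling points of [x]: it could
    only coincide with one of them if [y] were the inverse of [x]. *)
Lemma pingpong_index x y (j : int) : attracts y j -> y != inv_letter x ->
  exists2 n : int, attracts x n & n - half_step x < j < n + half_step x.
Proof.
move=> yj yx; have [n xn /andP[nj jn]] := nearest_attractor x j.
exists n => //; rewrite jn andbT lt_neqAle nj andbT.
apply: contraNneq yx => e; apply/eqP/(attracts_inj yj).
rewrite -e -(subrK (half_step x) n) -/(_ - _) in xn *.
have := attracts_inv (inv_letter x) (n - half_step x).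
by rewrite inv_letterK /= subrK in xn * => <-.
Qed.

End Positions.

(** * A map of the circle with one source and one sink *)

Section Stretch.
Variable R : realType.
Implicit Types (s t u : R) (q : int).

(** The restriction of the map to [0, 1], made of three segments of slopes 15,
    1/15 and 15: it fixes 0 and 1, which repel, and 1/2, which attracts. As a
    combination of increasing affine maps by min and max, it is defined and
    increasing on the whole line. *)
Definition bend t : R :=
  Num.min (15 * t) (Num.max ((t + 7) / 15) (15 * t - 14)).

(** Inverting an increasing map exchanges min and max. *)
Definition unbend t : R :=
  Num.max (t / 15) (Num.min (15 * t - 7) ((t + 14) / 15)).

(* The comparisons stay in the goal, so that the case analysis on an inner min
   or max also simplifies those that mention it. *)
Ltac split_minmax :=
  repeat match goal with
  | |- context [Num.min ?x ?y] => case: (leP x y)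
  | |- context [Num.max ?x ?y] => case: (leP x y)
  end.

Lemma bend_lt : {homo bend : s t / s < t}.
Proof. by move=> s t st; rewrite /bend; split_minmax => *; lra. Qed.

Lemma unbend_lt : {homo unbend : s t / s < t}.
Proof. by move=> s t st; rewrite /unbend; split_minmax => *; lra. Qed.

Lemma bendK : cancel bend unbend.
Proof. by move=> t; rewrite /bend /unbend; split_minmax => *; lra. Qed.

Lemma unbendK : cancel unbend bend.
Proof. by move=> t; rewrite /bend /unbend; split_minmax => *; lra. Qed.

Definition periodize (f : R -> R) t : R :=
  (Num.floor t)%:~R + f (t - (Num.floor t)%:~R).

Lemma periodizeE f q t : 0 <= t -> t < 1 ->
  periodize f (q%:~R + t) = q%:~R + f t.
Proof.
move=> t0 t1; suff -> : periodize f (q%:~R + t) = q%:~R + f (q%:~R + t - q%:~R).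
  by congr (_ + f _); lra.
by rewrite /periodize (@floor_def _ _ q)//; rewrite intrD1; lra.
Qed.

Lemma floor_decomp t : exists q s, [/\ t = q%:~R + s, 0 <= s & s < 1].
Proof.
exists (Num.floor t), (t - (Num.floor t)%:~R).
have := floor_le_tmp t; have := floorD1_gt t; rewrite intrD1 => h1 h2.
by split; lra.
Qed.

Lemma periodize_lt f : {homo f : s t / s < t} -> f 0 = 0 -> f 1 = 1 ->
  {homo periodize f : s t / s < t}.
Proof.
move=> fI f0 f1 s t.
have [p [u [-> u0 u1]]] := floor_decomp s; have [q [v [-> v0 v1]]] := floor_decomp t.
rewrite !periodizeE// => lt.
have fv : 0 <= f v by rewrite -f0; apply: (ltW_homo fI).
have fu : f u < 1 by rewrite -f1 fI.
have [pq|pq] := ltP p q.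
  by have : (p + 1)%:~R <= q%:~R :> R by [rewrite ler_int; lia]; rewrite intrD; lra.
have [qp|] := ltP q p; last move=> qp.
  by have : (q + 1)%:~R <= p%:~R :> R by [rewrite ler_int; lia]; rewrite intrD; lra.
have e : p = q by lia.
by move: lt; rewrite e !ltrD2l; exact: fI.
Qed.

Lemma periodizeK f g : {homo f : s t / s < t} -> f 0 = 0 -> f 1 = 1 ->
  cancel f g -> cancel (periodize f) (periodize g).
Proof.
move=> fI f0 f1 fK t; have [q [u [-> u0 u1]]] := floor_decomp t.
rewrite periodizeE// periodizeE ?fK//; last by rewrite -f1 fI.
by rewrite -f0; apply: (ltW_homo fI).
Qed.

Lemma periodizeD f q t : periodize f (t + q%:~R) = periodize f t + q%:~R.
Proof.
have [p [u [-> u0 u1]]] := floor_decomp t.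
by rewrite addrAC -intrD !periodizeE// intrD addrAC.
Qed.

Definition stretch := periodize bend.

Lemma bend0 : bend 0 = 0. Proof. by rewrite /bend; split_minmax => *; lra. Qed.
Lemma bend1 : bend 1 = 1. Proof. by rewrite /bend; split_minmax => *; lra. Qed.
Lemma unbend0 : unbend 0 = 0. Proof. by rewrite /unbend; split_minmax => *; lra. Qed.
Lemma unbend1 : unbend 1 = 1. Proof. by rewrite /unbend; split_minmax => *; lra. Qed.

(** The corners of [bend] are at distance 1/32 from 0 and 1 and are sent at
    distance 1/32 from 1/2, and the middle slope is less than 1; hence the bound
    for every [u >= 1/32], which serves for [a] with [u] = 1/16 and for [b] and
    [c] with [u] = 1/32. *)
Lemma stretch_contract q u t : 1 / 32 <= u -> u < 1 / 2 ->
  q%:~R + u <= t -> t <= q%:~R + 1 - u ->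
  q%:~R + (1 / 2 - u) <= stretch t /\ stretch t <= q%:~R + (1 / 2 + u).
Proof.
move=> u0 u1 t0 t1.
have -> : t = q%:~R + (t - q%:~R) by lra.
rewrite /stretch periodizeE; [|lra..].
suff: 1 / 2 - u <= bend (t - q%:~R) /\ bend (t - q%:~R) <= 1 / 2 + u by lra.
by rewrite /bend; split_minmax => *; lra.
Qed.

End Stretch.

(** * The generators *)

Section PingPong.
Variable R : realType.
Implicit Types (s t : R) (g : generator) (x y : letter)
  (n j k : int) (v w : seq letter) (F G : Homeo R) (S : set R).

(** Conjugates [f] by the affine map that sends the repelling points of [g] to
    the integers. For [g = ga] the unit interval becomes half of the circle:
    this is the lift through the double cover. *)
Definition rescale (f : R -> R) g t : R :=
  let r := (attractor (g, false))%:~R in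
  let p := (2 * half_step (g, true))%:~R in
  (r + p * f ((8 * t - r) / p)) / 8.

Lemma rescale_lt f g : {homo f : s t / s < t} -> {homo rescale f g : s t / s < t}.
Proof.
move=> fI s t st; rewrite /rescale.
suff: f ((8 * s - (attractor (g, false))%:~R) / (2 * half_step (g, true))%:~R) <
      f ((8 * t - (attractor (g, false))%:~R) / (2 * half_step (g, true))%:~R).
  by case: g => /=; rewrite /half_step /=; lra.
by apply: fI; case: g => /=; rewrite /half_step /=; lra.
Qed.

Lemma rescaleK f h g : cancel f h -> cancel (rescale f g) (rescale h g).
Proof.
move=> fK t; rewrite /rescale; set r := _%:~R; set p := _%:~R.
have p0 : p != 0 by rewrite /p; case: (g); rewrite /half_step /= intr_eq0.
have -> : 8 * ((r + p * f ((8 * t - r) / p)) / 8) - r = p * f ((8 * t - r) / p).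
  by lra.
by rewrite [X in h X]mulrC mulKf// fK [p * _]mulrC divfK//; lra.
Qed.

Lemma stretch_lt : {homo @stretch R : s t / s < t}.
Proof. exact: (periodize_lt (@bend_lt R) (bend0 R) (bend1 R)). Qed.

Lemma unstretch_lt : {homo periodize (@unbend R) : s t / s < t}.
Proof. exact: (periodize_lt (@unbend_lt R) (unbend0 R) (unbend1 R)). Qed.

Lemma generator_map_homeomorphism g : homeomorphism (rescale (@stretch R) g).
Proof.
apply: (@monotone_inverse_homeomorphism _ _ (rescale (periodize (@unbend R)) g)).
- exact/rescale_lt/stretch_lt.
- exact/rescale_lt/unstretch_lt.
- exact/rescaleK/(periodizeK (@bend_lt R) (bend0 R) (bend1 R))/bendK.
- exact/rescaleK/(periodizeK (@unbend_lt R) (unbend0 R) (unbend1 R))/unbendK.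
Qed.

Definition generator_map g : Homeo R := MkHomeo (generator_map_homeomorphism g).

Lemma generator_mapZ g : Homeo_Z (generator_map g).
Proof.
split=> [s t /(rescale_lt g stretch_lt)//|t].
rewrite /= /rescale; set r := _%:~R; set p := _%:~R.
have [n pn] : exists n : int, p * n%:~R = 8.
  by case: (g) @p => p; [exists 2|exists 1..]; rewrite /p /half_step /=; lra.
have p0 : p != 0 by rewrite /p; case: (g); rewrite /half_step /= intr_eq0.
have -> : (8 * (t + 1) - r) / p = (8 * t - r) / p + n%:~R.
  by apply: (mulIf p0); rewrite divfK// [RHS]mulrDl divfK// [n%:~R * p]mulrC pn; lra.
by rewrite /stretch periodizeD mulrDr pn; lra.
Qed.

Notation letter_map := (letter_eval generator_map).
Notation word_map := (word_eval generator_map).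

Lemma letter_mapZ x : Homeo_Z (letter_map x).
Proof.
by rewrite /letter_eval; case: ifP => _; [|apply: HomeoZV]; exact: generator_mapZ.
Qed.

Definition window n t : bool := n%:~R - 1 / 4 <= 8 * t <= n%:~R + 1 / 4.

(** For a generator this is [stretch_contract]. The inverse of a generator
    inherits it: knowing where the generator sends the two ends of the window of
    [n], which sit next to the repelling point [n], bounds its inverse. *)
Lemma letter_map_contract x n t : attracts x n ->
  (n - half_step x)%:~R + 1 / 4 <= 8 * t ->
  8 * t <= (n + half_step x)%:~R - 1 / 4 ->
  window n (letter_map x t).
Proof.
have pos g k s : attracts (g, true) k ->
    (k - half_step (g, true))%:~R + 1 / 4 <= 8 * s ->
    8 * s <= (k + half_step (g, true))%:~R - 1 / 4 ->
    window k (generator_map g s).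
  move=> gk lo hi.
  have [q {}gk] : exists q : int, k = attractor (g, false)
      + 2 * half_step (g, true) * q + half_step (g, true).
    move: gk => /dvdzP[q]; case: (g); rewrite /half_step /= => kE;
      by [exists q; lia|exists (q - 1); lia].
  have := @stretch_contract R q (1 / (4 * (2 * half_step (g, true))%:~R))
    ((8 * s - (attractor (g, false))%:~R) / (2 * half_step (g, true))%:~R).
  move: lo hi; rewrite gk /window /= /rescale !(intrD, rmorphB) /=.
  rewrite [(_ * q)%:~R]intrM.
  have e4 : (2 * 2)%:~R = 4 :> R by [].
  have e8 : (2 * 4)%:~R = 8 :> R by [].
  by case: (g); rewrite /half_step /= ?e4 ?e8 => lo hi H; have [] := H; lra.
case: x => g [] xn lo hi; first exact: pos.
have GZ := generator_mapZ g; rewrite /letter_eval /=.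
have hm : half_step (g, false) = half_step (g, true) by [].
have m1 : 1 <= (half_step (g, true))%:~R :> R by rewrite ler1z; case: (g).
have np : attracts (g, true) (n + half_step (g, true)).
  by rewrite -hm (attracts_inv (g, false)).
have nm : attracts (g, true) (n - half_step (g, true)).
  by rewrite -(attracts_inv (g, true)) subrK in xn *.
rewrite hm rmorphB /= in lo; rewrite hm intrD in hi.
have /andP[lo' _] : window (n + half_step (g, true))
    (generator_map g ((n%:~R + 1 / 4) / 8)).
  by apply: (pos g _ _ np); rewrite ?addrK ?intrD; lra.
have /andP[_ hi'] : window (n - half_step (g, true))
    (generator_map g ((n%:~R - 1 / 4) / 8)).
  by apply: (pos g _ _ nm); rewrite ?subrK ?rmorphB; lra.
rewrite intrD in lo'; rewrite mulrzBr in hi'.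
rewrite /window; set v := (X in 8 * X).
have vlo : (n%:~R - 1 / 4) / 8 <= v by rewrite -(HomeoZ_le GZ) /v homeoKV; lra.
have vhi : v <= (n%:~R + 1 / 4) / 8 by rewrite -(HomeoZ_le GZ) /v homeoKV; lra.
by apply/andP; split; lra.
Qed.

Lemma word_mapZ w : Homeo_Z (word_map w).
Proof.
elim: w => [|x w IH]; first exact: HomeoZ1.
exact: HomeoZM (letter_mapZ _) IH.
Qed.

(** * Ping-pong *)

Lemma letter_map_window x (j n : int) t : attracts x n ->
  n - half_step x < j < n + half_step x ->
  window j t -> window n (letter_map x t).
Proof.
move=> xn /andP[nj jn] /andP[jt tj]; apply: letter_map_contract => //.
  have : (n - half_step x + 1)%:~R <= j%:~R :> R by rewrite ler_int; lia.
  by rewrite intrD; lra.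
have : (j + 1)%:~R <= (n + half_step x)%:~R :> R by rewrite ler_int; lia.
by rewrite intrD; lra.
Qed.

(** A single window has to receive the whole of [S]: this is what produces fixed
    points when [S] is itself a window. *)
Definition lands x S F := exists2 n : int, attracts x n &
  forall t, S t -> window n (F t).

(** The point 1/16 is halfway between the positions 0 and 1, thus outside the
    windows around the repelling points, whatever the letter. *)
Lemma lands_base x : lands x [set 1 / 16] (letter_map x).
Proof.
have [n xn /andP[n0 n1]] := nearest_attractor x 0; exists n => // _ ->.
apply: letter_map_contract => //.
  have : (n - half_step x)%:~R <= (0 : int)%:~R :> R by rewrite ler_int.
  by lra.
have : (1 : int)%:~R <= (n + half_step x)%:~R :> R by rewrite ler_int; lia.
by lra.
Qed.

Lemma lands_window x y j : attracts y j -> no_cancel x y ->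
  lands x [set t | window j t] (letter_map x).
Proof.
move=> yj yx; have [n xn nj] := pingpong_index yj yx.
by exists n => // t; exact: letter_map_window.
Qed.

Lemma lands_word x v S : path no_cancel x v ->
  lands (last x v) S (letter_map (last x v)) -> lands x S (word_map (x :: v)).
Proof.
elim: v x => [|y v IH] x /=.
  by move=> _ [n xn H]; exists n => // t /H; rewrite mulg1.
move=> /andP[xy /IH{}IH] /IH [j yj jS].
have [n xn nS] := lands_window yj xy.
by exists n => // t /jS/nS.
Qed.

Lemma reduced_word_moves x v (k : int) : path no_cancel x v ->
  word_map (x :: v) (1 / 16) <> 1 / 16 + k%:~R.
Proof.
move=> /lands_word/(_ (lands_base _))[n _ /(_ _ erefl)] /andP[lo hi] e.
rewrite e in lo hi.
(* The position of 1/16 + k is 1/2 + 8 k, at distance at least 1/2 from n. *)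
have l : (4 * n)%:~R <= (3 + 32 * k)%:~R :> R by rewrite intrD !intrM; lra.
have h : (1 + 32 * k)%:~R <= (4 * n)%:~R :> R by rewrite intrD !intrM; lra.
rewrite !ler_int in l h; lia.
Qed.

Lemma window_fixpoint (n k : int) F : Homeo_Z F ->
  (forall t, window n t -> window (n + 8 * k) (F t)) ->
  exists2 t, window n t & F t = t + k%:~R.
Proof.
move=> FZ nF; pose lo : R := (n%:~R - 1 / 4) / 8; pose hi : R := (n%:~R + 1 / 4) / 8.
pose f t := F t - t.
have cf : continuous f.
  by move=> t; apply: cvgB; [exact: (homeoP F).1|exact: cvg_id].
have flo : k%:~R <= f lo.
  have /nF : window n lo by rewrite /window /lo; lra.
  by rewrite /window /f intrD intrM /lo; lra.
have fhi : f hi <= k%:~R.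
  have /nF : window n hi by rewrite /window /hi; lra.
  by rewrite /window /f intrD intrM /hi; lra.
have [|||t + ft] := @IVT R f lo hi k%:~R.
- by rewrite /lo /hi; lra.
- exact: continuous_subspaceT.
- by rewrite ge_min le_max flo fhi orbT.
rewrite in_itv /= => tI; exists t; first by move: tI; rewrite /window /lo /hi; lra.
by rewrite -ft /f; lra.
Qed.

Definition fixes_mod_int F := exists t (k : int), F t = t + k%:~R.

Lemma fixes_mod_int_conj F G : Homeo_Z G ->
  fixes_mod_int F -> fixes_mod_int (G * F * G^-1)%g.
Proof.
move=> GZ [t [k Ft]]; exists (G t), k.
by rewrite !homeoME homeoVK Ft HomeoZ_add_int.
Qed.

Lemma letter_fixpoint x n : attracts x n ->
  exists2 t, window n t & letter_map x t = t.
Proof.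
move=> xn; have [||t nt e] := @window_fixpoint n 0 (letter_map x).
- exact: letter_mapZ.
- move=> t; rewrite mulr0 addr0; apply: letter_map_window => //.
  by case: (x) => [[] []]; rewrite /half_step /=; lia.
by exists t => //; rewrite e addr0.
Qed.

(** The property only depends on the conjugacy class, that is on the cyclic
    word, and does not change when two inverse letters that are neighbours in
    the cyclic word are erased; so one can argue by induction on the length. *)
Lemma word_fixes_mod_int w : fixes_mod_int (word_map w).
Proof.
have [m] := ubnP (size w); elim: m w => // m IH w; rewrite ltnS => wm.
have [/allP wa|] := boolP (all (fun x => x.1 == ga) w).
  have [t _ at_] := @letter_fixpoint (ga, true) 2 isT.
  exists t, 0; rewrite addr0; elim: w wa {wm} => // -[g b] w IHw wa /=.
  rewrite IHw; last by move=> y yw; apply: wa; rewrite in_cons yw orbT.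
  have /= /eqP -> := wa _ (mem_head _ _).
  case: b wa => // _; rewrite -[(ga, false)]/(inv_letter (ga, true)) letter_evalV.
  by rewrite -[in LHS]at_ homeoVK.
(* Some letter is not a power of [a]: rotate the word to begin with it. *)
move=> /allPn [x xw xa].
have [w1 [w2 wE]] : exists w1 w2, w = w1 ++ x :: w2.
  by case/splitPr: xw => w1 w2; exists w1, w2.
pose v := w2 ++ w1.
have sv : size w = (size v).+1 by rewrite wE !size_cat /= addnS addnC.
suff H : fixes_mod_int (word_map (x :: v)).
  have -> : word_map w = (word_map w1 * word_map (x :: v) * (word_map w1)^-1)%g.
    by rewrite wE /v -cat_cons !word_eval_cat [in RHS]mulgA mulgK.
  exact/fixes_mod_int_conj/H/word_mapZ.
have [xv|/path_cancel[s1 [y [s2 e]]]] := boolP (path no_cancel x v); last first.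
  rewrite e word_eval_cancel; apply: IH; move: (congr1 size e).
  by rewrite !size_cat /= -sv; lia.
have [lx|lx] := boolP (no_cancel (last x v) x); last first.
  case: (lastP v) sv lx {xv} => [|v' z] sv.
    by rewrite /= /no_cancel; case: (x) => [[] []].
  rewrite last_rcons /no_cancel negbK => /eqP ->.
  rewrite -cats1 -cat_cons word_eval_cat /= mulg1 letter_evalV.
  have := @fixes_mod_int_conj (word_map v') ((letter_map z)^-1)%g.
  rewrite invgK; apply; first exact/HomeoZV/letter_mapZ.
  by apply: IH; move: wm; rewrite sv size_rcons; lia.
(* The word is cyclically reduced. It sends the window of [n] into a window
   of [x], and all the windows of [x] are equal mod 8. *)
pose n := attractor x; have xn : attracts x n by rewrite /attracts subrr dvdz0.
have [k xk H] := lands_word xv (lands_window xn lx).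
have [q e] : exists q : int, k = n + 8 * q.
  have : (8 %| k - n)%Z.
    by move: xk xa; rewrite /attracts /n; case: (x) => [[] []].
  by move=> /dvdzP[q e]; exists q; lia.
have [|t _ tE] := @window_fixpoint n q (word_map (x :: v)) (word_mapZ _).
  by move=> t /H; rewrite e.
by exists t, q.
Qed.

End PingPong.

(** * The free group *)

Section Multiplicative.
Variables (G H : groupType) (f : G -> H) (fM : {morph f : x y / (x * y)%g}).
Definition multiplicative_of : {multiplicative G -> H} :=
  HB.pack_for {multiplicative G -> H} f (isMultiplicative.Build G H f fM).
End Multiplicative.

Lemma multiplicative1 (G H : groupType) (f : {multiplicative G -> H}) : f 1%g = 1%g.
Proof. by apply: (mulgI (f 1%g)); rewrite -gmulfM !mulg1. Qed.

Lemma multiplicativeV (G H : groupType) (f : {multiplicative G -> H}) x :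
  f (x^-1)%g = ((f x)^-1)%g.
Proof. by apply: (mulgI (f x)); rewrite -gmulfM !mulgV multiplicative1. Qed.

Lemma multiplicative_word (G H : groupType) (f : {multiplicative G -> H})
    (s : generator -> G) w :
  f (word_eval s w) = word_eval (f \o s) w.
Proof.
elim: w => [|[g b] w IH] /=; first exact: multiplicative1.
by rewrite gmulfM IH; case: b => //=; rewrite multiplicativeV.
Qed.

Section Group.
Variable R : realType.
Implicit Types (v w : seq letter).
Notation word_map := (word_eval (@generator_map R)).

Definition is_word : pred (Homeo R) := fun F => `[< exists w, F = word_map w >].

Lemma is_word_closed : group_closed is_word.
Proof.
split; first by apply/asboolP; exists [::].
move=> _ _ /asboolP[v ->] /asboolP[w ->]; apply/asboolP.
by exists (v ++ inv_word w); rewrite word_eval_cat word_evalV.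
Qed.

Definition word_group := {F : Homeo R | is_word F}.
HB.instance Definition _ := SubChoice.on word_group.
HB.instance Definition _ :=
  SubChoice_isSubGroup.Build (Homeo R) is_word word_group is_word_closed.

Lemma gen_is_word g : is_word (generator_map R g).
Proof. by apply/asboolP; exists [:: (g, true)]; rewrite /= mulg1. Qed.

Definition gen_elt g : word_group := Sub (generator_map R g) (gen_is_word g).

Lemma val_word_eval w : val (word_eval gen_elt w) = word_map w.
Proof.
elim: w => [|[g b] w IH]; first exact: val1.
rewrite !word_eval_cons valM IH; congr (_ * _)%g; case: b; rewrite /letter_eval /=.
  by [].
exact: (gmulfV (val : word_group -> Homeo R) (gen_elt g)).
Qed.

Lemma word_groupP (X : word_group) : exists w, X = word_eval gen_elt w.
Proof.
have /asboolP[w wE] := valP X; exists w.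
by apply: val_inj; rewrite val_word_eval.
Qed.

(** A nonempty word that fixes 1/16 mod 1 is not reduced, and erasing a pair of
    inverse letters changes none of its evaluations. By induction, a relation
    between the generators holds in every group. *)
Lemma word_eval_trivial (H : groupType) (f : generator -> H) w (k : int) :
  word_map w (1 / 16) = 1 / 16 + k%:~R -> word_eval f w = 1%g.
Proof.
have [m] := ubnP (size w); elim: m w => // m IH [//|x w]; rewrite ltnS => wm.
have [xw /(reduced_word_moves xw)//|/path_cancel[s1 [y [s2 e]]]] :=
  boolP (path no_cancel x w).
rewrite e !word_eval_cancel; apply: IH; move: (congr1 size e) wm.
by rewrite /= !size_cat /=; lia.
Qed.

Lemma word_eval_eq (H : groupType) (f : generator -> H) v w :
  word_map v = word_map w -> word_eval f v = word_eval f w.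
Proof.
move=> vw; apply: (mulIg (word_eval f w)^-1%g); rewrite mulgV -word_evalV -word_eval_cat.
apply: (@word_eval_trivial _ _ _ 0).
by rewrite addr0 word_eval_cat word_evalV vw mulgV.
Qed.

Lemma word_group_free : free_group word_group.
Proof.
exists (range gen_elt) => H f.
pose word_of X := projT1 (cid (word_groupP X)).
have word_ofK X : word_eval gen_elt (word_of X) = X.
  by rewrite /word_of; case: cid.
pose phi X := word_eval (f \o gen_elt) (word_of X).
have phiE w : phi (word_eval gen_elt w) = word_eval (f \o gen_elt) w.
  by apply: word_eval_eq; rewrite -!val_word_eval word_ofK.
have phiM : {morph phi : x y / (x * y)%g}.
  by move=> X Y; rewrite -(word_ofK X) -(word_ofK Y) -word_eval_cat !phiE word_eval_cat.
exists (multiplicative_of phiM); split=> [_ [g _ <-]|psi psiE X] /=.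
  by have := phiE [:: (g, true)]; rewrite /= !mulg1.
rewrite -(word_ofK X) phiE multiplicative_word; congr word_eval.
by apply/funext => g /=; apply: psiE; exists g.
Qed.

Lemma word_group_fg : finitely_generated word_group.
Proof.
exists [:: gen_elt ga; gen_elt gb; gen_elt gc] => S Sg sub X.
have S1 := Sg.1; have SV := group_closedV Sg; have SM := group_closedM Sg.
have [w ->] := word_groupP X; elim: w => [//|[g b] w IH] /=.
apply: SM => //; have gS : gen_elt g \in S.
  by apply: sub; rewrite !inE; case: g; rewrite eqxx ?orbT.
by case: b; rewrite /letter_eval //=; exact: SV.
Qed.

Lemma word_group_nonabelian : nonabelian word_group.
Proof.
exists (gen_elt ga), (gen_elt gb) => ab.
pose w : seq letter := [:: (gb, true); (ga, false); (gb, false)].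
apply: (@reduced_word_moves R (ga, true) w 0) => //.
rewrite addr0 -val_word_eval.
suff -> : word_eval gen_elt ((ga, true) :: w) = 1%g by rewrite val1.
by rewrite !word_eval_cons /letter_eval /= mulg1 !mulgA ab mulgK mulgV.
Qed.

(** * The action on the circle *)

Lemma word_groupZ (X : word_group) : Homeo_Z (val X).
Proof. by have /asboolP[w ->] := valP X; exact: word_mapZ. Qed.

Definition circle_map (X : word_group) : Homeo (circle R) :=
  MkHomeo (circle_fun_homeomorphism (word_groupZ X)).

Lemma circle_map_projects (X : word_group) : projects (val X) (circle_map X).
Proof. by move=> t; rewrite /= circle_funE//; exact: word_groupZ. Qed.

Lemma circle_mapM : {morph circle_map : X Y / (X * Y)%g}.
Proof.
move=> X Y; apply: homeo_ext => z; rewrite -[z]creprK homeoME.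
by rewrite -!circle_map_projects valM.
Qed.

Lemma circle_map_plus X : Homeo_plus (circle_map X).
Proof. by exists (val X); [exact: word_groupZ|exact: circle_map_projects]. Qed.

Definition word_action : circle_action R word_group :=
  @CircleAction R word_group (multiplicative_of circle_mapM) circle_map_plus.

Lemma word_action_inj : injective word_action.
Proof.
move=> X Y XY; have [v vE] := word_groupP X; have [w wE] := word_groupP Y.
have /cproj_eq/intrP[k kE] : cproj (val X (val (Y^-1)%g (1 / 16))) = cproj (1 / 16).
  rewrite circle_map_projects [circle_map X]XY -circle_map_projects -homeoME -valM.
  by rewrite mulgV val1.
apply: (mulIg (Y^-1)%g); rewrite mulgV {1}vE {1}wE -word_evalV -word_eval_cat.
apply: (@word_eval_trivial _ _ _ k).
rewrite -val_word_eval word_eval_cat word_evalV -vE -wE valM homeoME -kE.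
by rewrite addrC subrK.
Qed.

Lemma word_action_rot (X : word_group) :
  is_rotation_number (word_action X) (cproj (0 : R)).
Proof.
move=> F FZ FX; have [w wE] := word_groupP X.
have [t [k tk]] := word_fixes_mod_int R w.
have /cproj_eq/intrP[m mE] : cproj (F t) = cproj (val X t).
  by rewrite FX circle_map_projects.
have {}mE : F t = t + (m + k)%:~R.
  by move: mE; rewrite wE val_word_eval tk intrD; lra.
exists (m + k)%:~R; first exact: translation_number_int mE.
by apply/cproj_eq; rewrite subr0 intr_int.
Qed.
End Group.

(** * Lifts of elements of PSL_2 and of its covers *)

Section PSL2Lifts.
Variable R : realType.
Implicit Types (F : Homeo R) (t u y p : R).

(** Since [f] covers a map of the circle, the increment of [F] over an interval
    of length 1/k is a multiple of 1/k. It is positive, and [k] such increments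
    add up to 1, so each of them is 1/k. *)
Lemma PSL2k_lift_commute k F (f : Homeo (circle R)) : (0 < k)%N ->
  Homeo_Z F -> projects F f -> PSL2k k f ->
  forall t, F (t + k%:R^-1) = F t + k%:R^-1.
Proof.
move=> k0 FZ Ff [_ [g _ fg]]; set p := k%:R^-1.
have K0 : 0 < k%:R :> R by rewrite ltr0n.
have p0 : 0 < p by rewrite invr_gt0.
have kp : k%:R * p = 1 by rewrite mulfV// gt_eqF.
have step t : F t + p <= F (t + p).
  have /cproj_eq/intrP[m mE] : cproj (k%:R * F (t + p)) = cproj (k%:R * F t).
    rewrite -!kcoverE !Ff !fg !kcoverE mulrDr kp; congr (g _).
    by apply/cproj_eq; rewrite addrAC subrr add0r rpred1.
  have m0 : 0 < m.
    rewrite -(ltr0z R) -mE -mulrBr pmulr_rgt0// subr_gt0 HomeoZ_lt//; lra.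
  have : 1 <= m%:~R :> R by rewrite ler1z; lia.
  by rewrite -mE -mulrBr -{1}kp (ler_pM2l K0); lra.
have steps (i : nat) t : F t + i%:R * p <= F (t + i%:R * p).
  elim: i => [|i IH]; first by rewrite mul0r !addr0.
  by rewrite -natr1 mulrDl mul1r !addrA; apply: le_trans (step _); rewrite lerD2r.
move=> t; apply/le_anti; rewrite step andbT.
have := steps k.-1 (t + p).
have e : k.-1%:R * p = 1 - p.
  by rewrite -subn1 natrB// mulrBl mul1r kp.
rewrite e; have -> : t + p + (1 - p) = t + 1 by lra.
by rewrite FZ.2; lra.
Qed.

Lemma sin_pi_eq0 t : -1 < t -> t < 1 -> sin (pi * t) = 0 -> t = 0.
Proof.
have pos s : 0 < s -> s < 1 -> 0 < sin (pi * s) :> R.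
  move=> s0 s1; apply: sin_gt0_pi; rewrite mulr_gt0 ?pi_gt0//=.
  by rewrite gtr_pMr ?pi_gt0.
move=> l1 l2 s0; have [tn|tp|//] := ltgtP t 0.
  have := pos (- t); rewrite mulrN sinN s0 oppr0 ltxx => H.
  by have : false by apply: H; lra.
by have := pos t tp l2; rewrite s0 ltxx.
Qed.

Lemma det2E (A : 'M[R]_2) : \det A = A 0 0 * A 1 1 - A 0 1 * A 1 0.
Proof.
rewrite (expand_det_row _ 0) !big_ord_recl big_ord0 /cofactor !det_mx11 !mxE /=.
rewrite expr0 expr1 mul1r addr0 mulN1r mulrN.
by congr (A 0 0 * A _ _ - A 0 _ * A _ _); apply: val_inj.
Qed.

(** The vectors [(C i, S i)] span three distinct eigenlines of the matrix with
    rows [(a, b)] and [(d, e)]. Any of them has nonzero coordinates in the basis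
    formed by the two others, so the three eigenvalues are equal. *)
Lemma three_eigenlines (C S c : 'I_3 -> R) (a b d e : R) :
  (forall i, a * C i + b * S i = c i * C i) ->
  (forall i, d * C i + e * S i = c i * S i) ->
  (forall i j, i != j -> C i * S j - C j * S i != 0) ->
  [/\ a = e, b = 0 & d = 0].
Proof.
move=> E1 E2 D.
(* Any three vectors of the plane satisfy the relation
   D' j k v_i + D' k i v_j + D' i j v_k = 0. Subtract c k times this relation
   from its image by the matrix and take the determinant with v_j. *)
pose D' i j := C i * S j - C j * S i.
have key i j k : i != j -> j != k -> c i = c k.
  move=> ij jk.
  have H1 : D' j k * (c i * C i) + D' k i * (c j * C j) + D' i j * (c k * C k) = 0.
    by rewrite -!E1 /D'; lra.
  have H2 : D' j k * (c i * S i) + D' k i * (c j * S j) + D' i j * (c k * S k) = 0.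
    by rewrite -!E2 /D'; lra.
  have H : D' j k * (c i - c k) * D' i j = 0.
    transitivity
      ((D' j k * (c i * C i) + D' k i * (c j * C j) + D' i j * (c k * C k)) * S j
      - (D' j k * (c i * S i) + D' k i * (c j * S j) + D' i j * (c k * S k)) * C j).
      by rewrite /D'; lra.
    by rewrite H1 H2; lra.
  move/eqP: H; rewrite !mulf_eq0 (negPf (D _ _ ij)) (negPf (D _ _ jk)) orbF /=.
  by rewrite subr_eq0 => /eqP.
have c01 : c ord0 = c 1 by apply: (key ord0 ord_max 1).
have n01 : D' ord0 1 != 0 by exact: D.
have solve x y : x * C ord0 + y * S ord0 = 0 -> x * C 1 + y * S 1 = 0 ->
    x = 0 /\ y = 0.
  move=> e0 e1.
  have F1 : x * D' ord0 1 = 0.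
    transitivity ((x * C ord0 + y * S ord0) * S 1 - (x * C 1 + y * S 1) * S ord0).
      by rewrite /D'; lra.
    by rewrite e0 e1; lra.
  have F2 : y * D' ord0 1 = 0.
    transitivity ((x * C 1 + y * S 1) * C ord0 - (x * C ord0 + y * S ord0) * C 1).
      by rewrite /D'; lra.
    by rewrite e0 e1; lra.
  move/eqP: F1; move/eqP: F2; rewrite !mulf_eq0 (negPf n01) !orbF.
  by move=> /eqP -> /eqP ->.
have E10 := E1 ord0; have E11 := E1 1; have E20 := E2 ord0; have E21 := E2 1.
rewrite -c01 in E11 E21.
have [||ac ->] := solve (a - c ord0) b; [lra..|].
have [||-> ec] := solve d (e - c ord0); [lra..|].
by split=> //; lra.
Qed.

(** The three fixed points are eigenlines of the matrix of [g], which is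
    therefore scalar; then [g] is the identity, and the lift [F], having fixed
    points, cannot be a nontrivial translation. *)
Lemma PSL2_three_fixpoints F g u v w : PSL2 g -> Homeo_Z F -> projects F g ->
  u < v -> v < w -> w < u + 1 -> F u = u -> F v = v -> F w = w ->
  forall t, F t = t.
Proof.
move=> [A detA gA] FZ Fg uv vw wu Fu Fv Fw.
have AF t : exists c,
    A 0 0 * cos (pi * t) + A 0 1 * sin (pi * t) = c * cos (pi * F t) /\
    A 1 0 * cos (pi * t) + A 1 1 * sin (pi * t) = c * sin (pi * F t).
  have [c /matrixP cE] := gA t (F t) (esym (Fg t)); exists c.
  have o1 : lift 0 (0 : 'I_1) = 1 :> 'I_2 by apply: val_inj.
  have := cE 0 0; have := cE 1 0.
  by rewrite !mxE !big_ord_recl !big_ord0 !mxE /= !addr0 !o1.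
have [c1 [E1 E1']] := AF u; have [c2 [E2 E2']] := AF v; have [c3 [E3 E3']] := AF w.
rewrite Fu in E1 E1'; rewrite Fv in E2 E2'; rewrite Fw in E3 E3'.
pose z (i : 'I_3) := nth 0 [:: u; v; w] i.
have [|||a11 a01 a10] := @three_eigenlines
   (fun i => cos (pi * z i)) (fun i => sin (pi * z i))
   (fun i => nth 0 [:: c1; c2; c3] i) (A 0 0) (A 0 1) (A 1 0) (A 1 1).
- by case=> -[|[|[]]].
- by case=> -[|[|[]]].
- move=> i j ij; apply/eqP => s0.
  have : z j - z i = 0.
    apply: sin_pi_eq0; last by rewrite mulrBr sinB -s0; lra.
    + by case: i j {ij s0} => -[|[|[]]]// ? [[|[|[]]]]// ?; rewrite /z /=; lra.
    + by case: i j {ij s0} => -[|[|[]]]// ? [[|[|[]]]]// ?; rewrite /z /=; lra.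
  by case: i j ij {s0} => -[|[|[]]]// ? [[|[|[]]]]// ?; rewrite /z /=; lra.
move=> t; have [d [d1 d2]] := AF t.
rewrite det2E a01 -a11 mul0r subr0 in detA; rewrite -a11 a01 a10 in d1 d2.
have a0 : A 0 0 != 0 by apply: contra_eq_neq detA => ->; rewrite mul0r eq_sym oner_eq0.
suff : F t - t = 0 by lra.
have [lo hi] := @fixpoint_displacement R F 1 u t FZ ltr01 FZ.2 Fu.
apply: sin_pi_eq0; [lra..|].
apply: (mulfI a0); rewrite mulr0 mulrBr sinB.
transitivity (sin (pi * F t) * (A 0 0 * cos (pi * t) + 0 * sin (pi * t)) -
  cos (pi * F t) * (0 * cos (pi * t) + A 0 0 * sin (pi * t))); first lra.
by rewrite d1 d2; lra.
Qed.

End PSL2Lifts.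

(** * Semi-conjugacy to an action in a cover of PSL_2 *)

Section Semiconj.
Variable R : realType.
Notation word_map := (word_eval (@generator_map R)).
Notation letter_map := (letter_eval (@generator_map R)).
Notation L := (word_group R).
Notation gen := (@gen_elt R).

(** Any lift of [word_action] to the central extension contains the tautological
    lift [val], as a section over the group; [Psi] is the other lift restricted
    to this section. *)
Lemma semiconjugate_lift (psi : circle_action R L) :
  semiconjugate (word_action R) psi ->
  exists (h : R -> R) (Psi : L -> Homeo R),
    [/\ {homo h : s t / s <= t}, forall t, h (t + 1) = h t + 1,
        {morph Psi : X Y / (X * Y)%g},
        forall X, Homeo_Z (Psi X) /\ projects (Psi X) (psi X)
      & forall (X : L) t, h (val X t) = Psi X (h t)].
Proof.
move=> [Lt [q [j [r0 [r1 [_ _ [_ jT _ [_ r0inj r0sur]] [r1Z j1T r1p _]]]]]]].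
move=> [h [_ hI hE]].
have liftX (X : L) : exists x, r0 x = val X /\ q x = X.
  have [|x _ [e1 e2]] := r0sur (val X, X); last by exists x.
  by split=> /=; [exact: word_groupZ|exact: circle_map_projects].
pose lift X := projT1 (cid (liftX X)).
have [lift0 liftq] : (forall X, r0 (lift X) = val X) /\ (forall X, q (lift X) = X).
  by split=> X; rewrite /lift; case: cid => x [].
exists h, (r1 \o lift); split=> //.
- by move=> t; rewrite -(jT t) hE j1T.
- move=> X Y /=; rewrite -gmulfM; congr (r1 _); apply: r0inj; rewrite ?inE//.
  by rewrite !gmulfM !lift0 !liftq valM.
- by move=> X; split; [exact: r1Z|have := r1p (lift X); rewrite liftq].
- by move=> X t /=; rewrite -lift0 hE.
Qed.

(** The repelling points d and d + 4 of [x] bound an arc which contains both its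
    attracting point d + 2 and the attracting point d + 1 of [y], whose
    repelling point d + 5 is in the opposite arc. The examples are [a], [b] with
    d = 0 and a^-1, [c] with d = 2. *)
Definition transverse x y (d : int) : bool :=
  [&& half_step x == 2, half_step y == 4, attracts x (d + 2) & attracts y (d + 1)].

(** Each letter carries the moving point past the next obstacle. Starting in the
    window of d + 6, the successive windows are those of d + 9, d + 10, d + 13
    and d + 14; the last one is the first one translated by 1. *)
Lemma full_turn x y d : transverse x y d ->
  exists z : R, z + 1 <= word_map [:: x; inv_letter y; x; y] z.
Proof.
move=> /and4P[/eqP hx /eqP hy xd yd]; pose z : R := (d%:~R + 6 - 1 / 4) / 8.
exists z; have z0 : window (d + 6) z by rewrite /window /z intrD; lra.
have xn n : (4 %| n - (d + 2))%Z -> attracts x n.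
  by move: xd; rewrite /attracts hx; lia.
have yn : attracts y (d + 9) by move: yd; rewrite /attracts hy; lia.
have hy' : half_step (inv_letter y) = 4 by rewrite -hy.
have y'n : attracts (inv_letter y) (d + 13).
  by rewrite (_ : d + 13 = d + 9 + half_step y) ?attracts_inv// hy; lia.
have s1 : window (d + 9) (letter_map y z).
  by apply: letter_map_window z0; rewrite // hy; lia.
have s2 : window (d + 10) (letter_map x (letter_map y z)).
  by apply: letter_map_window s1; [apply: xn; lia|rewrite hx; lia].
have s3 : window (d + 13) (letter_map (inv_letter y) (letter_map x (letter_map y z))).
  by apply: letter_map_window s2; rewrite // hy'; lia.
have /andP[+ _] : window (d + 14)
    (letter_map x (letter_map (inv_letter y) (letter_map x (letter_map y z)))).
  by apply: letter_map_window s3; [apply: xn; lia|rewrite hx; lia].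
by rewrite intrD /= /z; lra.
Qed.

Section Contradiction.
Variables (h : R -> R) (Psi : L -> Homeo R) (psi : circle_action R L) (k : nat).
Hypotheses (hI : {homo h : s t / s <= t}) (hT : forall t, h (t + 1) = h t + 1)
  (PsiM : {morph Psi : X Y / (X * Y)%g})
  (PsiZ : forall X, Homeo_Z (Psi X) /\ projects (Psi X) (psi X))
  (hE : forall (X : L) t, h (val X t) = Psi X (h t))
  (k0 : (0 < k)%N) (psik : forall X, PSL2k k (psi X)).

Notation letter_elt := (letter_eval gen).

Lemma val_letter x : val (letter_elt x) = letter_map x.
Proof. by have := val_word_eval R [:: x]; rewrite /= !mulg1. Qed.

Lemma image_turn x y d : transverse x y d ->
  exists z, z + 1 <= Psi (word_eval gen [:: x; inv_letter y; x; y]) z.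
Proof.
move=> /full_turn[z zW]; exists (h z).
by rewrite -hE val_word_eval -hT; exact: hI.
Qed.

Lemma image_fixpoint (X : L) t : val X t = t -> Psi X (h t) = h t.
Proof. by move=> e; rewrite -hE e. Qed.

(** The image of an element with a fixed point has a fixed point, and commutes
    with the translation by 1/k. *)
Lemma image_displacement (X : L) t s : val X t = t -> Psi X s < s + k%:R^-1.
Proof.
move=> e; have p0 : 0 < k%:R^-1 :> R by rewrite invr_gt0 ltr0n.
have [PZ Pp] := PsiZ X.
by have [] := @fixpoint_displacement R (Psi X) _ (h t) s PZ p0
  (PSL2k_lift_commute k0 PZ Pp (psik X)) (image_fixpoint e).
Qed.

(** The full turn a b^-1 a b is the product of [a] and of b^-1 a b. Both have
    fixed points, so their images together advance by less than 2/k. *)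
Lemma degree_one : k = 1%N.
Proof.
have [z zW] := @image_turn (ga, true) (gb, true) 0 isT.
have [t _ at_] := @letter_fixpoint R (ga, true) 2 isT.
have [s bs] : exists s, letter_map (gb, true) s = t.
  by exists ((letter_map (gb, true))^-1%g t); rewrite homeoKV.
pose X := letter_elt (ga, true); pose Y := letter_elt (gb, true).
have WE : word_eval gen [:: (ga, true); (gb, false); (ga, true); (gb, true)]
    = (X * (Y^-1 * X * Y))%g.
  by rewrite !word_eval_cons /= mulg1 -!mulgA.
have /(image_displacement (Psi (Y^-1 * X * Y)%g z)) dX : val X t = t by rewrite val_letter.
have /(image_displacement z) dY : val (Y^-1 * X * Y)%g s = s.
  rewrite !valM !homeoME !val_letter bs at_ -bs -val_letter -homeoME -valM.
  by rewrite mulVg val1.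
rewrite [word_eval _ _]WE PsiM homeoME in zW.
have [k2|] := ltnP 1 k; last by move=> ?; apply/eqP; rewrite eqn_leq; apply/andP.
have : k%:R^-1 <= 2^-1 :> R by rewrite lef_pV2 ?posrE ?ltr0n// ler_nat.
by move=> kh; exfalso; lra.
Qed.

(** A common fixed point would be fixed by the image of the word that makes a
    full turn, and no point can be carried that far past a fixed point. *)
Lemma no_common_fixpoint x y d u : transverse x y d ->
  Psi (letter_elt x) u = u -> Psi (letter_elt y) u <> u.
Proof.
move=> /image_turn[z zW] xu yu.
have Psi1 : Psi 1%g = 1%g by apply: (mulgI (Psi 1%g)); rewrite -PsiM !mulg1.
have y'u : Psi (letter_elt (inv_letter y)) u = u.
  by rewrite -[in LHS]yu -homeoME -PsiM letter_evalV mulVg Psi1.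
have [PZ _] := PsiZ (word_eval gen [:: x; inv_letter y; x; y]).
have [|_] := @fixpoint_displacement R _ 1 u z PZ ltr01 PZ.2; last by lra.
by rewrite !word_eval_cons !PsiM !homeoME Psi1 yu xu y'u xu.
Qed.

(** If [h] collapsed the interval from [s] to [t], the image of [u] would be
    fixed by the images of both letters. *)
Lemma separated x y d s u t : transverse x y d -> s <= u -> u <= t ->
  letter_map x s = s -> letter_map y u = u -> h s < h t.
Proof.
move=> xyd su ut xs yu; rewrite lt_neqAle (hI (le_trans su ut)) andbT.
apply/eqP => st; have us : h u = h s.
  by apply/le_anti; rewrite (hI su) {1}st (hI ut).
apply: (no_common_fixpoint xyd (u := h s)).
  by apply: image_fixpoint; rewrite val_letter.
by rewrite -us; apply: image_fixpoint; rewrite val_letter.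
Qed.

Lemma not_PSL2k : False.
Proof.
(* The windows give the order t0 < t1 < ... < t5 < t0 + 1. The generator [a]
   fixes t0, t2 and t4; each gap between them contains a fixed point t1, t3 or
   t5 of [b] or [c]. *)
have fixa t : letter_map (ga, false) t = t -> letter_map (ga, true) t = t.
  by move=> e; rewrite -[in LHS]e -[(ga, false)]/(inv_letter (ga, true))
    letter_evalV homeoKV.
have fixb t : letter_map (gb, false) t = t -> letter_map (gb, true) t = t.
  by move=> e; rewrite -[in LHS]e -[(gb, false)]/(inv_letter (gb, true))
    letter_evalV homeoKV.
have fixa' t : letter_map (ga, true) t = t -> letter_map (ga, false) t = t.
  by move=> e; rewrite -[in LHS]e -[(ga, false)]/(inv_letter (ga, true))
    letter_evalV homeoVK.
have [t0 /andP[l0 r0] /fixa e0] := @letter_fixpoint R (ga, false) 0 isT.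
have [t1 /andP[l1 r1] e1] := @letter_fixpoint R (gb, true) 1 isT.
have [t2 /andP[l2 r2] e2] := @letter_fixpoint R (ga, true) 2 isT.
have [t3 /andP[l3 r3] e3] := @letter_fixpoint R (gc, true) 3 isT.
have [t4 /andP[l4 r4] e4] := @letter_fixpoint R (ga, false) 4 isT.
have [t5 /andP[l5 r5] /fixb e5] := @letter_fixpoint R (gb, false) 5 isT.
have ab : transverse (ga, true) (gb, true) 0 by [].
have ac : transverse (ga, false) (gc, true) 2 by [].
have h02 : h t0 < h t2 by apply: (separated ab) e0 e1; lra.
have h24 : h t2 < h t4 by apply: (separated ac) (fixa' _ e2) e3; lra.
have h40 : h t4 < h t0 + 1.
  by rewrite -hT; apply: (separated ab) (fixa _ e4) e5; lra.
pose X := letter_elt (ga, true); have [PZ Pp] := PsiZ X.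
have [_ [g gP kg]] := psik X.
have Pg : projects (Psi X) g.
  move=> t; have := kg (cproj t); rewrite -Pp !kcoverE degree_one !mul1r.
  by move=> ->.
have Xid := PSL2_three_fixpoints gP PZ Pg h02 h24 h40.
apply: (no_common_fixpoint ab (u := h t1)); last first.
  by apply: image_fixpoint; rewrite val_letter.
by apply: Xid; apply: image_fixpoint; rewrite val_letter//; exact: fixa.
Qed.

End Contradiction.
End Semiconj.

Theorem theorem1p15 (R : realType) :
  exists (L : groupType) (phi : circle_action R L),
    [/\ free_group L /\ finitely_generated L /\ nonabelian L,
        injective phi,
        (forall g : L, is_rotation_number (phi g) (cproj (0%R : R)))
      & forall k : nat, (1 <= k)%N ->
          forall psi : circle_action R L,
            (forall g : L, PSL2k k (psi g)) -> ~ semiconjugate phi psi].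
Proof.
exists (word_group R), (word_action R); split.
- split; [exact: word_group_free|split; [exact: word_group_fg|exact: word_group_nonabelian]].
- exact: word_action_inj.
- exact: word_action_rot.
move=> k k0 psi psik /semiconjugate_lift[h [Psi [hI hT PsiM PsiZ hE]]].
exact: (not_PSL2k hI hT PsiM PsiZ hE k0 psik).
Qed.
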